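(* For all integers $1\le k\le n$, $$V_{n,k}(t)=\sum_{\sigma\in\mathcal{VS}^{(B)}_{n,n-k+1}}t^{\,n+1-2\cdot \mathsf{neg}(\sigma)}\qquad\text{and}\qquad V_{n,-k}(t)=\sum_{\sigma\in\mathcal{VS}^{(D)}_{n,n-k+1}}t^{\,n+1-2\cdot \mathsf{neg}(\sigma)}.$$
   Context: Arnold–Hoffman polynomials: for integers $1\le |k|\le n$ define $V_{n,k}(t)$ by $V_{1,1}=t^2$, $V_{1,-1}=1$, $V_{n,-n}=0$ for $n\ge 2$, and $V_{n,-k}=V_{n,-k-1}+t^{-1}V_{n-1,k}$ for $n>k\ge 1$; $V_{n,1}=t^2V_{n,-1}$ for $n\ge2$; $V_{n,k}=V_{n,k-1}+tV_{n-1,-k+1}$ for $n\ge k>1$. A signed permutation of $[n]$ is written in window notation $\sigma=\sigma_1\cdots\sigma_n$ ($\sigma_i=\sigma(i)\in[\pm n]$, $|\sigma_1|,\dots,|\sigma_n|$ a permutation of $[n]$); $\bar a=-a$; $|\sigma|=|\sigma_1|\cdots|\sigma_n|$. For a sequence $w=w_1\cdots w_n$ of distinct positive integers, position $i$ (or $w_i$) is a valley if $2\le i\le n-1$ and $w_{i-1}>w_i<w_{i+1}$, or $i=1$ and $w_1<w_2$. $\mathcal{VS}^{(B)}_n$: signed permutations $\sigma$ such that whenever $\sigma_i<0$, we have $i\ge2$ and $|\sigma_{i-1}|$ is a valley of $|\sigma|$ (in particular $\sigma_1>0$). $\mathcal{VS}^{(B)}_{n,k}$: those with $\sigma_1=k$.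 $\mathcal{VS}^{(D)}_n$: signed permutations $\sigma$ with $\sigma_1<0$, $|\sigma_1|>\sigma_2>0$ (when $n\ge 2$), and such that for $i\ge 3$, $\sigma_i<0$ implies $|\sigma_{i-1}|$ is a valley of $|\sigma|$. $\mathcal{VS}^{(D)}_{n,k}$: those with $\sigma_1=\bar k$. $\mathsf{neg}(\sigma)=\#\{i:\sigma_i<0\}$. *)

(* Defs.v *)
From mathcomp Require Import all_boot all_order all_fingroup all_algebra.
From mathcomp Require Import zify.

Set Implicit Arguments.
Unset Strict Implicit.
Unset Printing Implicit Defensive.

Import GRing.Theory.
Local Open Scope ring_scope.

(* The recurrence divides by t, so the V_{n,k} live in the field Z(t), which
   contains the Laurent polynomials in the indeterminate t. *)
Notation Zt := {fraction {poly int}}.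

Definition t : Zt := FracField.tofrac 'X.

(* Given the row prev = V_{n-1,.}, [AH_neg n prev d] is V_{n,-(n-d)} and
   [AH_pos n prev k] is V_{n,k}. *)
Fixpoint AH_neg (n : nat) (prev : int -> Zt) (d : nat) : Zt :=
  if d is d'.+1 then AH_neg n prev d' + t^-1 * prev (n - d)%N%:Z else 0.

Fixpoint AH_pos (n : nat) (prev : int -> Zt) (k : nat) : Zt :=
  match k with
  | 0 => 0
  | 1 => t ^+ 2 * AH_neg n prev n.-1
  | k'.+1 => AH_pos n prev k' + t * prev (- k%:Z + 1)
  end.

(* V_{n,k}; meaningful for 1 <= |k| <= n only. *)
Fixpoint AH (n : nat) (k : int) : Zt :=
  match n with
  | 0 => 0
  | 1 => if k == 1 then t ^+ 2 else if k == -1 then 1 else 0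
  | n'.+1 => if 0 <= k then AH_pos n (AH n') `|k|%N
             else AH_neg n (AH n') (n - `|k|)%N
  end.

Lemma AH_1_1 : AH 1 1 = t ^+ 2. Proof. by []. Qed.

Lemma AH_1_N1 : AH 1 (- 1) = 1. Proof. by []. Qed.

Lemma AH_Nn n : (2 <= n)%N -> AH n (- n%:Z) = 0.
Proof. by case: n => [|[|n]] //= _; rewrite subnn. Qed.

Lemma AH_N n k : (1 <= k < n)%N ->
  AH n (- k%:Z) = AH n (- k%:Z - 1) + t^-1 * AH n.-1 k%:Z.
Proof.
case: n => [|[|n]]; [lia | lia |].
case: k => [|k] // /andP[_ ltkn].
have -> : - k.+1%:Z - 1 = - k.+2%:Z by lia.
have rowE j : AH n.+2 (- j.+1%:Z) = AH_neg n.+2 (AH n.+1) (n.+2 - j.+1)%N by [].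
rewrite !rowE; have -> : (n.+2 - k.+1 = (n.+2 - k.+2).+1)%N by lia.
have -> : k.+1%:Z = (n.+2 - (n.+2 - k.+2).+1)%N%:Z by lia.
by [].
Qed.

Lemma AH_1 n : (2 <= n)%N -> AH n 1 = t ^+ 2 * AH n (- 1).
Proof. by case: n => [|[|n]] //= _; rewrite !subn1. Qed.

Lemma AH_S n k : (1 < k <= n)%N ->
  AH n k%:Z = AH n (k%:Z - 1) + t * AH n.-1 (- k%:Z + 1).
Proof.
case: n => [|[|n]]; [lia | lia |].
by case: k => [|[|k]].
Qed.

(* A signed permutation sigma of [n] is encoded by |sigma| (as a permutation of
   {0, .., n-1}) and by the positions at which sigma is negative. *)
Definition signed_perm (n : nat) : finType :=
  ('S_n * {ffun 'I_n -> bool})%type.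

(* The window sigma_1 ... sigma_n, with values in {-n, .., -1, 1, .., n}. *)
Definition window n (s : signed_perm n) : seq int :=
  [seq (if s.2 i then - (s.1 i).+1%:Z else (s.1 i).+1%:Z) | i <- enum 'I_n].

Definition abs_window n (s : signed_perm n) : seq nat :=
  [seq `|x|%N | x <- window s].

(* Positions are numbered from 1, as in the window notation:
   [entry s i] is sigma_i. *)
Definition entry n (s : signed_perm n) (i : nat) : int := (window s)`_i.-1.

Lemma entryE n (s : signed_perm n) (i : 'I_n) :
  entry s i.+1 = if s.2 i then - (s.1 i).+1%:Z else (s.1 i).+1%:Z.
Proof. by rewrite /entry /= (nth_map i) ?size_enum_ord // nth_ord_enum. Qed.

Definition valley (w : seq nat) (i : nat) : bool :=
  let w_ j := nth 0%N w j.-1 in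
  [&& (2 <= i)%N, (i <= (size w).-1)%N, (w_ i < w_ i.-1)%N & (w_ i < w_ i.+1)%N]
  || [&& i == 1%N, (2 <= size w)%N & (w_ 1%N < w_ 2%N)%N].

(* The number i : 'I_n stands for the position i.+1. *)
Definition VSB (n : nat) : {set signed_perm n} :=
  [set s | [forall i : 'I_n,
    (entry s i.+1 < 0) ==> (2 <= i.+1)%N && valley (abs_window s) i]].

Definition VSBk (n k : nat) : {set signed_perm n} :=
  [set s in VSB n | entry s 1 == k%:Z].

Definition VSD (n : nat) : {set signed_perm n} :=
  [set s | [&& entry s 1 < 0,
    (2 <= n)%N ==> (0 < entry s 2 < `|entry s 1|) &
    [forall i : 'I_n, (3 <= i.+1)%N && (entry s i.+1 < 0) ==>
       valley (abs_window s) i]]].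

Definition VSDk (n k : nat) : {set signed_perm n} :=
  [set s in VSD n | entry s 1 == - k%:Z].

Definition neg n (s : signed_perm n) : nat :=
  #|[set i : 'I_n | entry s i.+1 < 0]|.

(* Main.v *)
(* The valleys of |sigma| can be chosen negative (one step later) independently,
   so summing over the signs leaves t^(n+1) x^(number of valleys of pi), with
   x = 1 + t^-2, summed over the permutations pi with a given first letter a.
   In the second family pi must moreover start with a descent, and the forced
   first sign costs t^-2.  Removing the first letter of pi then gives
   recurrences in a which are the ones defining V_{n,k} with k = n - a + 1. *)
Require Import Defs.
From mathcomp Require Import all_boot all_order all_fingroup all_algebra.
From mathcomp Require Import zify ring.
Import GRing.Theory.
Local Open Scope ring_scope.

(** * Valleys of a word and the effect of a new first letter *)

(** Past the end of [w] letters read as 0, so an ascent at [i] already implies [i < size w]; the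
    cases of first and inner positions then merge. *)
Lemma valleyE (w : seq nat) (i : nat) :
  valley w i = [&& (0 < i)%N,
    (1 < i)%N ==> (nth 0%N w i.-1 < nth 0%N w i.-2)%N &
    (nth 0%N w i.-1 < nth 0%N w i)%N].
Proof.
have szP : (nth 0%N w i.-1 < nth 0%N w i)%N -> (i < size w)%N.
  by case: (ltnP i (size w)) => // le_w_i; rewrite (nth_default _ le_w_i).
rewrite /valley; case: i szP => [|[|i]] /= szP; rewrite ?andbF ?orbF //.
- by case: (boolP (_ < _)%N) szP => [_ -> | _ _]; rewrite ?andbF.
- case: (boolP (_ < nth _ _ i.+2)%N) szP => [_ szw | _ _]; rewrite ?andbF //.
  by have -> : (i.+1 < (size w).-1)%N by move: (szw isT); lia.
Qed.

(** Position 0 does not exist and the last position has no right neighbour; neither is a valley, so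
    this range misses none. *)
Definition nvalleys (w : seq nat) : nat := (\sum_(i < size w) valley w i)%N.

(** [bump h.+1] is strictly increasing and fixes the default value 0. *)
Lemma valley_map_bump (h : nat) (w : seq nat) (i : nat) :
  valley (map (bump h.+1) w) i = valley w i.
Proof.
have bump_nth j : nth 0%N (map (bump h.+1) w) j = bump h.+1 (nth 0%N w j).
  have [lt_j|le_j] := ltnP j (size w); first by rewrite (nth_map 0%N).
  by rewrite !nth_default ?size_map.
by rewrite !valleyE !bump_nth; congr [&& _, _ ==> _ & _]; rewrite /bump; lia.
Qed.

Lemma nvalleys_map_bump (h : nat) (w : seq nat) :
  nvalleys (map (bump h.+1) w) = nvalleys w.
Proof.
rewrite /nvalleys size_map; apply: eq_bigr => i _.
by rewrite valley_map_bump.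
Qed.

(** The letter [b], now second, stays a valley only if also [b < a]; the loss stands on the left to
    avoid subtraction. *)
Lemma nvalleys_cons2 (a b : nat) (w : seq nat) : a != b ->
  (nvalleys [:: a, b & w] + [&& a < b & b < nth 0 w 0] =
   (a < b) + nvalleys (b :: w))%N.
Proof.
move=> ne_ab; rewrite /nvalleys /= !big_ord_recl !valleyE /= !add0n.
rewrite -addnA; congr (_ + _)%N; case: w => [|c w] /=.
  by rewrite !big_ord0 ltn0 andbF.
rewrite !big_ord_recl !valleyE /=.
have -> : (\sum_(i < size w)
   valley [:: a, b, c & w] (bump 0 (bump 0 (bump 0 i))) =
   \sum_(i < size w) valley [:: b, c & w] (bump 0 (bump 0 i)))%N.
  by apply: eq_bigr => i _; rewrite !valleyE.
by lia.
Qed.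

(** * Words of permutations and removal of the first letter *)

(* Letters start at 1, so that the default value 0 read past the end of the word
   acts as a final descent. *)
Definition word {n : nat} (p : 'S_n) : seq nat :=
  [seq (p i).+1 | i <- enum 'I_n].

Lemma size_word (n : nat) (p : 'S_n) : size (word p) = n.
Proof. by rewrite size_map size_enum_ord. Qed.

Lemma nth_word (n : nat) (p : 'S_n) (i : 'I_n) : nth 0%N (word p) i = (p i).+1.
Proof. by rewrite (nth_map i) ?size_enum_ord // nth_ord_enum. Qed.

Lemma word_lift_perm (n : nat) (j : 'I_n.+1) (p : 'S_n) :
  word (lift_perm ord0 j p) = j.+1 :: map (bump j.+1) (word p).
Proof.
rewrite /word enum_ordSl /= lift_perm_id -!map_comp; congr (_ :: _).
by apply: eq_map => i /=; rewrite lift_perm_lift bumpS.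
Qed.

Lemma lift_permP (n : nat) (i j : 'I_n.+1) (p : 'S_n.+1) : p i = j ->
  exists q : 'S_n, p = lift_perm i j q.
Proof.
move=> pij.
have ne_j k : j != p (lift i k) by rewrite -pij (inj_eq perm_inj) neq_lift.
pose f k := s2val (unlift_some (ne_j k)).
have fE k : p (lift i k) = lift j (f k) := s2valP (unlift_some (ne_j k)).
have f_inj : injective f.
  by move=> k l eq_f; apply/(@lift_inj _ i)/(@perm_inj _ p); rewrite !fE eq_f.
exists (perm f_inj); apply/permP => k.
case: (unliftP i k) => [l|] ->; last by rewrite lift_perm_id.
by rewrite lift_perm_lift permE fE.
Qed.

Lemma lift_perm_inj (n : nat) (i j : 'I_n.+1) : injective (@lift_perm n i j).
Proof.
move=> p q eq_pq; apply/permP => k; apply: (@lift_inj _ j).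
by rewrite -!(lift_perm_lift i) eq_pq.
Qed.

(** Deleting the first letter and standardizing is a bijection, with inverse [lift_perm ord0 j]. *)
Lemma sum_word_head (R : nmodType) (n a : nat) (F : seq nat -> R) :
    (a <= n)%N ->
  \sum_(p : 'S_n.+1 | nth 0%N (word p) 0 == a.+1) F (word p) =
  \sum_(p : 'S_n) F (a.+1 :: map (bump a.+1) (word p)).
Proof.
move=> le_an; pose j : 'I_n.+1 := inord a.
have jE : j = a :> nat by rewrite inordK.
transitivity (\sum_(p in [set: 'S_n]) F (word (lift_perm ord0 j p)));
  last by apply: eq_big => p; rewrite ?inE // word_lift_perm jE.
rewrite -[RHS](@big_imset _ _ _ _ _ _ _ (fun p => F (word p)));
  last by move=> p q _ _; apply: lift_perm_inj.
apply: eq_bigl => p; rewrite -[0%N]/(val (@ord0 n)) nth_word eqSS -jE.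
apply/eqP/imsetP => [/val_inj/lift_permP[q ->]|[q _ ->]]; first by exists q.
by rewrite lift_perm_id.
Qed.

(** The last inequality also covers empty [w], since letters are positive and the default is 0. *)
Lemma word_consP (n : nat) (p : 'S_n.+1) : exists b w, word p = b :: w /\
  [/\ (0 < b)%N, (b <= n.+1)%N & b != nth 0%N w 0].
Proof.
exists (p ord0).+1, [seq (p (lift ord0 i)).+1 | i <- enum 'I_n].
split; first by rewrite /word enum_ordSl /= -map_comp.
split=> //.
case: n p => [|n] p; first by rewrite enum_ord0.
by rewrite enum_ordSl /= eqSS (inj_eq val_inj) (inj_eq perm_inj).
Qed.

(** * Valley sums with given first letter and their recurrences *)

Definition valley_sum {R : comNzRingType} (x : R) (n a : nat) : R :=
  \sum_(p : 'S_n | nth 0%N (word p) 0 == a) x ^+ nvalleys (word p).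

(** For [n = 1] the second letter reads as 0, so the one-letter word counts as starting with a
    descent. *)
Definition desc_valley_sum {R : comNzRingType} (x : R) (n a : nat) : R :=
  \sum_(p : 'S_n | (nth 0%N (word p) 0 == a) && (nth 0%N (word p) 1 < a)%N)
    x ^+ nvalleys (word p).

Lemma valley_sum_rem {R : comNzRingType} (x : R) (n a : nat) : (a <= n)%N ->
  valley_sum x n.+1 a.+1 =
  \sum_(p : 'S_n) x ^+ nvalleys (a.+1 :: map (bump a.+1) (word p)).
Proof.
move=> le_an; rewrite /valley_sum.
by rewrite (sum_word_head _ _ _ (fun w => x ^+ nvalleys w)).
Qed.

(** The new letter starts a descent: it is no valley, and [b] keeps its status. *)
Lemma nvalleys_rem_desc (a b : nat) (w : seq nat) : (b < a.+1)%N ->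
  nvalleys (a.+1 :: map (bump a.+1) (b :: w)) = nvalleys (b :: w).
Proof.
move=> lt_ba; rewrite -(nvalleys_map_bump a (b :: w)) /=.
have bumpb : bump a.+1 b = b by rewrite /bump; lia.
rewrite bumpb.
have ne_ab : a.+1 != b by lia.
have := nvalleys_cons2 _ _ (map (bump a.+1) w) ne_ab.
have -> : (a.+1 < b)%N = false by lia.
by rewrite /= addn0 add0n.
Qed.

(** The new letter is a valley, while [b] ceases to be one if it was. *)
Lemma nvalleys_rem_asc (a b : nat) (w : seq nat) : (a.+1 <= b)%N ->
  (nvalleys (a.+1 :: map (bump a.+1) (b :: w)) + (b < nth 0 w 0) =
    (nvalleys (b :: w)).+1)%N.
Proof.
move=> le_ab; rewrite -(nvalleys_map_bump a (b :: w)) /=.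
have ne_ab : a.+1 != bump a.+1 b by rewrite /bump; lia.
have := nvalleys_cons2 _ _ (map (bump a.+1) w) ne_ab.
have -> : (bump a.+1 b < nth 0 (map (bump a.+1) w) 0)%N = (b < nth 0 w 0)%N.
  by case: w => [|c w] /=; rewrite /bump; lia.
by have -> : (a.+1 < bump a.+1 b)%N by rewrite /bump; lia.
Qed.

Lemma desc_valley_sum_rem {R : comNzRingType} (x : R) (n a : nat) :
    (a <= n.+1)%N ->
  desc_valley_sum x n.+2 a.+1 =
  \sum_(p : 'S_n.+1 | (nth 0%N (word p) 0 < a.+1)%N) x ^+ nvalleys (word p).
Proof.
move=> le_an; rewrite /desc_valley_sum big_mkcondr /=.
(* The descent condition moves into the summand, because [sum_word_head] fixes only the first
   letter. *)
rewrite (sum_word_head _ _ _ (fun w =>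
  if (nth 0 w 1 < a.+1)%N then x ^+ nvalleys w else 0)) // [RHS]big_mkcond /=.
apply: eq_bigr => p _; have [b [w [-> _]]] := word_consP _ p => /=.
have -> : (bump a.+1 b < a.+1)%N = (b < a.+1)%N by rewrite /bump; lia.
by case: ifP => // lt_ba; rewrite -[_ :: map _ _]/(map _ (b :: w))
  nvalleys_rem_desc.
Qed.

Lemma desc_valley_sum1 {R : comNzRingType} (x : R) (n : nat) :
  desc_valley_sum x n.+2 1 = 0.
Proof.
rewrite desc_valley_sum_rem // big1 // => p.
by have [b [w [-> [/= b_gt0 _ _]]]] := word_consP _ p; lia.
Qed.

(** Raising the bound on the second letter by one admits exactly one new value; this mirrors the
    recurrence for $V_{n,-k}$. *)
Lemma desc_valley_sumS {R : comNzRingType} (x : R) (n a : nat) : (a < n.+1)%N ->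
  desc_valley_sum x n.+2 a.+2 =
  desc_valley_sum x n.+2 a.+1 + valley_sum x n.+1 a.+1.
Proof.
move=> lt_an; rewrite !desc_valley_sum_rem; [|lia..].
rewrite (bigID (fun p => nth 0 (word p) 0 < a.+1)%N) /=; congr (_ + _).
  by apply: eq_bigl => p; lia.
by apply: eq_bigl => p; lia.
Qed.

(** A word starting with its largest letter starts with a descent; this mirrors
    $V_{n,1}=t^2V_{n,-1}$. *)
Lemma valley_sum_last {R : comNzRingType} (x : R) (n : nat) :
  valley_sum x n.+2 n.+2 = desc_valley_sum x n.+2 n.+2.
Proof.
rewrite valley_sum_rem // desc_valley_sum_rem // [RHS]big_mkcond /=.
apply: eq_bigr => p _; have [b [w [-> [_ le_bn _]]]] := word_consP _ p => /=.
by rewrite ltnS le_bn -[_ :: map _ _]/(map _ (b :: w)) nvalleys_rem_desc.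
Qed.

(* After removal of the first letter, only the words starting with [a.+1]
   contribute to the difference: those with an ascent cancel, those with a
   descent give [x - 1]. *)
Lemma valley_sumS {R : comNzRingType} (x : R) (n a : nat) : (a < n.+1)%N ->
  valley_sum x n.+2 a.+1 =
  valley_sum x n.+2 a.+2 + (x - 1) * desc_valley_sum x n.+1 a.+1.
Proof.
move=> lt_an; rewrite !valley_sum_rem; [|lia..]; rewrite /desc_valley_sum.
rewrite [X in _ * X]big_mkcond big_distrr -big_split /=; apply: eq_bigr => p _.
have [b [w [-> [_ _ ne_bw]]]] := word_consP _ p.
have [lt_ba | lt_ab | eq_ba] := ltngtP b a.+1.
- by rewrite !nvalleys_rem_desc ?mulr0 ?addr0 //; lia.
- have := nvalleys_rem_asc _ _ w lt_ab.
  have := nvalleys_rem_asc _ _ w (ltnW lt_ab).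
  by rewrite /= mulr0 addr0 => ? ?; congr (_ ^+ _); lia.
rewrite eq_ba in ne_bw *.
have := nvalleys_rem_asc _ _ w (leqnn a.+1).
rewrite (nvalleys_rem_desc a.+1) //=.
have [lt_w | lt_w | /eqP] := ltngtP; last by rewrite (negPf ne_bw).
- by rewrite addn1 => -[->]; rewrite mulr0 addr0.
- by rewrite addn0 => ->; rewrite exprS; ring.
Qed.

Lemma valley_sum1 {R : comNzRingType} (x : R) : valley_sum x 1 1 = 1.
Proof.
rewrite valley_sum_rem // (eq_bigr (fun => 1)) => [|p _].
  by rewrite sumr_const card_Sn.
by rewrite (size0nil (size_word _ p)) /nvalleys big_ord_recl big_ord0 valleyE.
Qed.

Lemma desc_valley_sum_1_1 {R : comNzRingType} (x : R) :
  desc_valley_sum x 1 1 = 1.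
Proof.
rewrite -[RHS](valley_sum1 x); apply: eq_bigl => p.
by rewrite [nth _ _ 1]nth_default ?andbT // size_word.
Qed.

(** * Identification of $V_{n,k}$ with valley sums *)

Lemma t_neq0 : t != 0.
Proof. by rewrite tofrac_eq0 polyX_eq0. Qed.

Local Notation xt := (1 + t ^- 2).

(** Both signs are proved together, since each row uses the previous one with the opposite sign. *)
Lemma AH_valley_sum (m k : nat) : (1 <= k <= m.+1)%N ->
  AH m.+1 k%:Z = t ^+ m.+2 * valley_sum xt m.+1 (m.+1 - k).+1 /\
  AH m.+1 (- k%:Z) = t ^+ m * desc_valley_sum xt m.+1 (m.+1 - k).+1.
Proof.
have t0 := t_neq0.
elim: m k => [|m IHm] k.
  have [-> _|] := eqVneq k 1%N; last by lia.
  by rewrite AH_1_1 AH_1_N1 subnn valley_sum1 desc_valley_sum_1_1 !mulr1.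
(* Within a row, induct on [j] = $n-k$, from $V_{n,-n}=0$ up to $V_{n,-1}$. *)
have AHneg j : (j <= m.+1)%N ->
    AH m.+2 (- (m.+2 - j)%N%:Z) = t ^+ m.+1 * desc_valley_sum xt m.+2 j.+1.
  elim: j => [_|j IHj lt_jm].
    by rewrite subn0 AH_Nn // desc_valley_sum1 mulr0.
  rewrite AH_N; last by lia.
  have -> : - (m.+2 - j.+1)%N%:Z - 1 = - (m.+2 - j)%N%:Z by lia.
  rewrite IHj 1?ltnW // (IHm (m.+2 - j.+1)%N _).1; last by lia.
  have -> : (m.+1 - (m.+2 - j.+1) = j)%N by lia.
  by rewrite desc_valley_sumS // (exprS _ m.+1) -mulrA mulKf // mulrDr.
(* Here [j] = $k-1$; the start $V_{n,1}$ comes from the end $V_{n,-1}$ of the negative half. *)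
have AHpos j : (j <= m.+1)%N ->
    AH m.+2 j.+1%:Z = t ^+ m.+3 * valley_sum xt m.+2 (m.+2 - j).
  elim: j => [_|j IHj lt_jm].
    rewrite AH_1 //; have -> : -1 = - (m.+2 - m.+1)%N%:Z by lia.
    by rewrite AHneg // subn0 valley_sum_last mulrA -exprD.
  rewrite AH_S; last by lia.
  have -> : j.+2%:Z - 1 = j.+1%:Z by lia.
  have -> : - j.+2%:Z + 1 = - j.+1%:Z by lia.
  rewrite IHj 1?ltnW // (IHm j.+1 _).2; last by lia.
  have -> : (m.+2 - j = (m.+1 - j.+1).+2)%N by lia.
  have -> : (m.+2 - j.+1 = (m.+1 - j.+1).+1)%N by lia.
  rewrite [in RHS]valley_sumS; last by lia.
  (* The factor $x-1$ equals $t^{-2}$, and $t^{m+3}t^{-2}=t\cdot t^m$. *)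
  rewrite [1 + _]addrC addrK [RHS]mulrDr [in RHS]mulrA; congr (_ + _).
  by rewrite mulrA -exprS -(addn2 m.+1) exprD mulfK // expf_neq0.
move=> /andP[k_gt0 le_km]; split.
  case: k k_gt0 le_km => // k _ le_km; rewrite AHpos //.
  by congr (_ * valley_sum _ _ _); lia.
rewrite -AHneg; last by lia.
by congr (AH _ (- Posz _)); lia.
Qed.

(** * Summation over the signs *)

Lemma entry_lt0 (n : nat) (s : signed_perm n) (i : 'I_n) :
  (entry s i.+1 < 0) = s.2 i.
Proof. by rewrite entryE; case: (s.2 i); lia. Qed.

Lemma abs_windowE (n : nat) (s : signed_perm n) : abs_window s = word s.1.
Proof.
rewrite /abs_window /window -map_comp; apply: eq_map => i /=.
by case: (s.2 i); lia.
Qed.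

Lemma weight_prod (n : nat) (s : signed_perm n) :
  t ^ (n%:Z + 1 - 2 * (neg s)%:Z) =
  t ^+ n.+1 * \prod_i (if s.2 i then t ^- 2 else 1).
Proof.
have t0 := t_neq0.
rewrite -big_mkcond prodr_const expfzDr //; congr (_ * _).
  by have -> : n%:Z + 1 = n.+1%:Z by lia.
have -> : neg s = #|[pred i | s.2 i]|.
  by apply: eq_card => i; rewrite inE entry_lt0.
by rewrite -exprVn -exprM -PoszM -exprnN exprVn.
Qed.

(** The constraint acts on each sign separately, so the sum of products factors by
    distributivity. *)
Lemma sum_signs (n : nat) (Q : 'I_n -> pred bool) (y : Zt) :
  \sum_(f : {ffun 'I_n -> bool} | [forall i, Q i (f i)])
     \prod_i (if f i then y else 1) =
  \prod_i ((if Q i true then y else 0) + (if Q i false then 1 else 0)).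
Proof.
rewrite (eq_bigl (mem (family Q))) => [|f]; last first.
  by apply/forallP/familyP.
rewrite -(bigA_distr_big_dep _ (fun i b => if b then y else 1)) /=.
by apply: eq_bigr => i _; rewrite big_mkcond big_bool.
Qed.

Lemma prod_valleys (n : nat) (p : 'S_n) (y : Zt) :
  \prod_(i < n) (if valley (word p) i then y else 1) = y ^+ nvalleys (word p).
Proof.
rewrite /nvalleys size_word -prodrXr.
by apply: eq_bigr => i _; case: valley; rewrite ?expr0 ?expr1.
Qed.

Lemma sum_VSBk (m a : nat) :
  \sum_(s in VSBk m.+1 a) t ^ (m.+1%:Z + 1 - 2 * (neg s)%:Z) =
  t ^+ m.+2 * valley_sum xt m.+1 a.
Proof.
(* Index [i] is position [i.+1], so its sign is governed by position [i]; [valley _ 0] is false,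
   which forces the first sign to be positive. *)
pose Q (p : 'S_m.+1) (i : 'I_m.+1) b := b ==> valley (word p) i.
rewrite /valley_sum big_distrr /=.
transitivity (\sum_(p : 'S_m.+1 | nth 0%N (word p) 0 == a)
    \sum_(f : {ffun 'I_m.+1 -> bool} | [forall i, Q p i (f i)])
      t ^+ m.+2 * \prod_i (if f i then t ^- 2 else 1)).
  rewrite pair_big_dep /=; apply: eq_big => [s | s _]; last exact: weight_prod.
  rewrite !inE -[0%N]/(val (@ord0 m)) nth_word.
  have -> : [forall i : 'I_m.+1, (entry s i.+1 < 0) ==>
      (2 <= i.+1)%N && valley (abs_window s) i] = [forall i, Q s.1 i (s.2 i)].
    apply: eq_forallb => i; rewrite entry_lt0 abs_windowE /Q valleyE.
    by rewrite ltnS; case: (0 < i)%N.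
  rewrite andbC (entryE s ord0); case: forallP; rewrite ?andbT ?andbF // => Qs.
  have := Qs ord0; rewrite /Q valleyE implybF => /negPf ->.
  by rewrite eqz_nat.
apply: eq_bigr => p _; rewrite -big_distrr sum_signs -prod_valleys.
congr (_ * _); apply: eq_bigr => i _ /=.
by rewrite /Q /=; case: valley; rewrite ?add0r // addrC.
Qed.

Lemma sum_VSDk (m a : nat) :
  \sum_(s in VSDk m.+1 a) t ^ (m.+1%:Z + 1 - 2 * (neg s)%:Z) =
  t ^+ m * desc_valley_sum xt m.+1 a.
Proof.
(* The first sign is forced negative. The second needs no clause of its own: after an initial
   descent position 1 is no valley, so it must be positive. *)
pose Q (p : 'S_m.+1) (i : 'I_m.+1) b :=
  if i == ord0 then b else b ==> valley (word p) i.
rewrite /desc_valley_sum big_distrr /=.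
transitivity (\sum_(p : 'S_m.+1 | (nth 0%N (word p) 0 == a) &&
      (nth 0%N (word p) 1 < a)%N)
    \sum_(f : {ffun 'I_m.+1 -> bool} | [forall i, Q p i (f i)])
      t ^+ m.+2 * \prod_i (if f i then t ^- 2 else 1)).
  rewrite pair_big_dep /=; apply: eq_big => [s | s _]; last exact: weight_prod.
  rewrite !inE.
  have E0 := entryE s ord0; have W0 := nth_word _ s.1 ord0.
  have [s0|s0] := boolP (s.2 ord0); last first.
    rewrite E0 (negPf s0) [_ < 0]ltz_nat.
    apply/esym/negbTE/negP => /andP[_ /forallP].
    by move/(_ ord0); rewrite /Q eqxx (negPf s0).
  rewrite s0 in E0; rewrite /= in W0; rewrite W0 E0 eqr_opp.
  have -> : (- (s.1 ord0).+1%:Z < 0) by lia.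
  have -> : `|- (s.1 ord0).+1%:Z| = (s.1 ord0).+1%:Z by lia.
  rewrite andTb andbC eqz_nat -andbA; case: eqP => // <-; rewrite !andTb.
  (* Stated for any index of value 1, as there is none when [m = 0]. *)
  have [entry2 word2] : (forall i : 'I_m.+1, i = 1%N :> nat ->
      entry s 2 = if s.2 i then - (s.1 i).+1%:Z else (s.1 i).+1%:Z) /\
      (forall i : 'I_m.+1, i = 1%N :> nat ->
      nth 0%N (word s.1) 1 = (s.1 i).+1).
    by split=> i i1; [rewrite -entryE i1 | rewrite -nth_word i1].
  apply/andP/andP => -[H2 /forallP Hs].
    split.
      have [lt1m|le_m1] := ltnP 1 m.+1; last first.
        by rewrite [nth _ _ 1]nth_default ?size_word.
      move: H2; rewrite lt1m (entry2 (Ordinal lt1m)) //.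
      rewrite (word2 (Ordinal lt1m)) //.
      by case: (s.2 _) => /=; lia.
    apply/forallP => i; rewrite /Q; case: eqVneq => [-> //|i_neq0].
    apply/implyP => si; have := Hs i; rewrite entry_lt0 si abs_windowE andbT.
    have [i1|i1] := eqVneq (i : nat) 1%N.
      have lt1m : (1 < m.+1)%N by rewrite -[X in (X < _)%N]i1.
      by move: H2; rewrite lt1m (entry2 _ i1) si.
    by move/implyP; apply; rewrite -val_eqE /= in i_neq0; lia.
  have Hs0 i : i != ord0 -> s.2 i -> valley (word s.1) i.
    by move=> i0 si; have := Hs i; rewrite /Q (negPf i0) si.
  split; last first.
    apply/forallP => i; apply/implyP => /andP[i_gt1].
    rewrite entry_lt0 abs_windowE; apply: Hs0; rewrite -val_eqE /=; lia.
  (* A negative second entry would make position 1 a valley, against the initial descent. *)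
  apply/implyP => lt1m; have := Hs0 (Ordinal lt1m) isT.
  rewrite valleyE /= W0; move: H2.
  rewrite (entry2 (Ordinal lt1m)) // (word2 (Ordinal lt1m)) //.
  move=> desc; case: (s.2 _) => [/(_ isT)|_ //] /=.
  by move/ltnW; rewrite leqNgt desc.
apply: eq_bigr => p /andP[/eqP <- desc_p].
rewrite -big_distrr sum_signs -prod_valleys /= !big_ord_recl.
(* Index 0 contributes only the forced $t^{-2}$, which lowers $t^{m+2}$ to $t^m$. *)
rewrite /Q eqxx addr0 mulrA -addn2 exprD mulfK ?expf_neq0 ?t_neq0 //.
congr (_ * _); rewrite valleyE mul1r; apply: eq_bigr => i _ /=.
by case: valley; rewrite ?add0r // addrC.
Qed.

Theorem theorem2p2 (n k : nat) (hk : (1 <= k <= n)%N) :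
  AH n k%:Z
    = \sum_(s in VSBk n (n - k + 1)%N) t ^ (n%:Z + 1 - 2 * (neg s)%:Z)
  /\
  AH n (- k%:Z)
    = \sum_(s in VSDk n (n - k + 1)%N) t ^ (n%:Z + 1 - 2 * (neg s)%:Z).
Proof.
case: n hk => [|m] hk; first by lia.
by rewrite addn1 sum_VSBk sum_VSDk; apply: AH_valley_sum.
Qed.
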